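(* Let $\lambda,\sigma,\tau>0$ be real, let $\eta_1,\eta_2$ be complex with $\Re(\eta_1)>0$, $\Re(\eta_2)>0$, and let $p,q$ be such that either $p,q\in\mathbb{C}$ with $\Re(p)>0$ and $\Re(q)>0$, or $p,q$ are real with $p\ge 0$ and $q\ge 0$. Let $a<c$ be real numbers. Then the following representations hold: $$B_{p,q}^{\lambda;\sigma,\tau}(\eta_1,\eta_2)=2\int_0^{\pi/2}\cos^{2\eta_1-1}\theta\,\sin^{2\eta_2-1}\theta\;E_\lambda\!\left(-\frac{p}{\cos^{2\sigma}\theta}\right)E_\lambda\!\left(-\frac{q}{\sin^{2\tau}\theta}\right)d\theta,$$ $$B_{p,q}^{\lambda;\sigma,\tau}(\eta_1,\eta_2)=\int_0^\infty\frac{u^{\eta_1-1}}{(1+u)^{\eta_1+\eta_2}}\,E_\lambda\!\left(-\frac{p(1+u)^\sigma}{u^\sigma}\right)E_\lambda\!\left(-q(1+u)^\tau\right)du,$$ $$B_{p,q}^{\lambda;\sigma,\tau}(\eta_1,\eta_2)=2^{1-\eta_1-\eta_2}\int_{-1}^1(1+u)^{\eta_1-1}(1-u)^{\eta_2-1}E_\lambda\!\left(-\frac{2^\sigma p}{(1+u)^\sigma}\right)E_\lambda\!\left(-\frac{2^\tau q}{(1-u)^\tau}\right)du,$$ $$B_{p,q}^{\lambda;\sigma,\tau}(\eta_1,\eta_2)=(c-a)^{1-\eta_1-\eta_2}\int_a^c(u-a)^{\eta_1-1}(c-u)^{\eta_2-1}E_\lambda\!\left(-\frac{p(c-a)^\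sigma}{(u-a)^\sigma}\right)E_\lambda\!\left(-\frac{q(c-a)^\tau}{(c-u)^\tau}\right)du.$$
   Context: $E_\lambda(x)=\sum_{n=0}^\infty \frac{x^n}{\Gamma(\lambda n+1)}$ is the Mittag-Leffler function. For real $\lambda,\sigma,\tau>0$ and complex $\eta_1,\eta_2,p,q$ with $\Re(\eta_1)>0$, $\Re(\eta_2)>0$, $\Re(p)\ge 0$, $\Re(q)\ge 0$, the extended beta function is $$B_{p,q}^{\lambda;\sigma,\tau}(\eta_1,\eta_2)=\int_0^1 t^{\eta_1-1}(1-t)^{\eta_2-1}E_\lambda\!\left(-\frac{p}{t^\sigma}\right)E_\lambda\!\left(-\frac{q}{(1-t)^\tau}\right)dt.$$ *)

(* Defs.v *)
From HB Require Import structures.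
From mathcomp Require Import all_boot all_order all_algebra.
From mathcomp Require Import all_classical all_reals all_analysis.

Set Implicit Arguments.
Unset Strict Implicit.
Unset Printing Implicit Defensive.

Import Order.TTheory GRing.Theory Num.Theory.
Import numFieldTopology.Exports numFieldNormedType.Exports.
(* last, so that [Re] and [Im] are the projections of [R[i]] *)
From mathcomp Require Import complex.

Local Open Scope classical_set_scope.
Local Open Scope ring_scope.
Local Open Scope complex_scope.

Definition cexp (R : realType) (z : R[i]) : R[i] :=
  (expR (Re z) * cos (Im z)) +i* (expR (Re z) * sin (Im z)).

(* [rcpow x z] is the principal power x^z of a real base [x]; it is only
   meaningful for [0 < x] (the library sets [ln x = 0] for [x <= 0]). *)
Definition rcpow (R : realType) (x : R) (z : R[i]) : R[i] :=
  cexp (z * (ln x)%:C).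

(* Integrals of complex-valued functions against Lebesgue measure, with the
   convention that the integral of a non-integrable function is 0. *)
Definition cintegrable (R : realType) (D : set R) (f : R -> R[i]) : Prop :=
  lebesgue_measure.-integrable D (fun x => (Re (f x))%:E) /\
  lebesgue_measure.-integrable D (fun x => (Im (f x))%:E).

Definition cintegral (R : realType) (D : set R) (f : R -> R[i]) : R[i] :=
  if `[< cintegrable D f >] then
    (\int[lebesgue_measure]_(x in D) Re (f x)) +i*
    (\int[lebesgue_measure]_(x in D) Im (f x))
  else 0.

(* Euler's Gamma function at a real [x > 0]. *)
Definition Gamma (R : realType) (x : R) : R :=
  \int[lebesgue_measure]_(t in `]0, +oo[) (t `^ (x - 1) * expR (- t)).

(* The limit is taken in [R[i]^o], which carries the topology of the complex
   modulus. *)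
Definition mittag_leffler (R : realType) (lambda : R) (z : R[i]) : R[i] :=
  limn (series (fun n : nat =>
    z ^+ n / (Gamma (lambda * n%:R + 1))%:C : R[i]^o)).

Definition ext_beta_integrand (R : realType) (lambda sigma tau : R)
    (p q eta1 eta2 : R[i]) (t : R) : R[i] :=
  rcpow t (eta1 - 1) * rcpow (1 - t) (eta2 - 1)
  * mittag_leffler lambda (- (p / (t `^ sigma)%:C))
  * mittag_leffler lambda (- (q / ((1 - t) `^ tau)%:C)).

(* The integrand is undefined at the endpoints, hence the open interval. *)
Definition ext_beta (R : realType) (lambda sigma tau : R)
    (p q eta1 eta2 : R[i]) : R[i] :=
  cintegral `]0, 1[ (ext_beta_integrand lambda sigma tau p q eta1 eta2).

(* Main.v *)
Require Import Defs.
From HB Require Import structures.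
From mathcomp Require Import all_boot all_order all_algebra.
From mathcomp Require Import all_classical all_reals all_analysis.

Import Order.TTheory GRing.Theory Num.Theory.
Import numFieldTopology.Exports numFieldNormedType.Exports.
From mathcomp Require Import complex.
From mathcomp Require Import measurable_realfun ring lra.

(** Each representation comes from a change of variables [t = phi u] in the
    integral over [`]0, 1[]: [phi u] is [cos u ^+ 2], [u / (1 + u)], and
    [(u - a) / (c - a)], the third representation being the fourth one for the
    interval from [-1] to [1].

    On the algebraic side, [ext_beta_integrand_ratio] computes the integrand
    at [x / (x + y)]: it is homogeneous in [x] and [y] up to a power of
    [x + y].  The pairs [(cos u ^+ 2, sin u ^+ 2)], [(u, 1)] and
    [(u - a, c - u)] give the integrands of the statement, up to the Jacobian
    and the constants [2], [1] and [(c - a)^(1 - eta1 - eta2)].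

    On the analytic side, the change of variables is proved for an arbitrary
    integrand, so that the Mittag-Leffler function can be treated as a black
    box.  The starting point is the identity of measures [lebesgue_measure A =
    \int_(phi @^-1` A) phi'] ([transports]), obtained by comparing the two
    sides on half-open intervals, where it is the fundamental theorem of
    calculus ([transports_increasing]); decreasing maps follow by reflection
    and unbounded domains by exhaustion.  It extends from indicator functions
    to nonnegative measurable functions ([transports_ge0_integral]), and then
    to all real and complex functions.  Since [phi] is a measurable bijection
    with measurable inverse and positive Jacobian, measurability, hence
    integrability, is transferred in both directions
    ([substitution_measurable], [substitution_integrable]).  In particular,
    if one integral diverges then so does the other, and both sides of the
    representation are then [0] by convention. *)

Local Open Scope classical_set_scope.
Local Open Scope ring_scope.
Local Open Scope complex_scope.

(** * Change of variables as an identity of measures *)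

(** The change of variables formula for indicator functions, in the case of a
    map [phi] from [D] onto [D'] with Jacobian [h]. *)
Definition transports {R : realType} (D : set R) (phi h : R -> R)
    (D' : set R) : Prop :=
  forall A : set R, measurable A ->
  lebesgue_measure (D' `&` A) =
  (\int[lebesgue_measure]_(x in D `&` phi @^-1` A) (h x)%:E)%E.

(** The proofs are arguments so that the measure structure can be attached to
    the set function itself.  The domain is [measurableTypeR R], on which
    [lebesgue_measure] is defined and which carries the uniqueness theorem for
    measures. *)
Definition pull_measure {R : realType} (D : set R) (phi h : R -> R)
    (mD : measurable D) (mphi : measurable_fun D phi)
    (mh : measurable_fun D h) (h_ge0 : forall x, D x -> 0 <= h x)
    (A : set (measurableTypeR R)) : \bar R :=
  (\int[lebesgue_measure]_(x in D `&` phi @^-1` A) (h x)%:E)%E.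

Section pull_measure.
Context {R : realType} (D : set R) (phi h : R -> R).
Hypotheses (mD : measurable D) (mphi : measurable_fun D phi).
Hypotheses (mh : measurable_fun D h) (h_ge0 : forall x, D x -> 0 <= h x).

Local Notation nu := (pull_measure D phi h mD mphi mh h_ge0).

Let nu0 : nu set0 = 0%E.
Proof. by rewrite /pull_measure preimage_set0 setI0 integral_set0. Qed.

Let nu_ge0 A : (0 <= nu A)%E.
Proof. by apply: integral_ge0 => x [/h_ge0 hx _]; rewrite lee_fin. Qed.

Let nu_sigma_additive : semi_sigma_additive nu.
Proof.
move=> F mF tF mUF; rewrite /pull_measure preimage_bigcup setI_bigcupr.
rewrite ge0_integral_bigcup.
- by apply: is_cvg_ereal_nneg_natsum_cond => n _ _; exact: nu_ge0.
- by move=> k; exact: (mphi mD (F k) (mF k)).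
- apply/measurable_EFinP; apply: measurable_funS mh => //.
  by move=> x [k _ []].
- by move=> x [k _ [Dx _]]; rewrite lee_fin h_ge0.
- apply/trivIsetP => i j _ _ ij.
  move/trivIsetP : tF => /(_ i j Logic.I Logic.I ij) Fij.
  rewrite -subset0 => x [[_ Fix] [_ Fjx]].
  by have : (F i `&` F j) (phi x) by []; rewrite Fij.
Qed.

HB.instance Definition _ := isMeasure.Build _ (measurableTypeR R) R nu
  nu0 nu_ge0 nu_sigma_additive.

End pull_measure.

(** Two measures that agree on the half-open intervals, which form a
    pi-system, agree on all Borel sets. *)
Lemma transports_ocitv {R : realType} (D D' : set R) (phi h : R -> R) :
  measurable D -> measurable_fun D phi -> measurable_fun D h ->
  (forall x, D x -> 0 <= h x) -> measurable D' ->
  (forall u v, u <= v -> lebesgue_measure (D' `&` `]u, v]) =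
     (\int[lebesgue_measure]_(x in D `&` phi @^-1` `]u, v]) (h x)%:E)%E) ->
  transports D phi h D'.
Proof.
move=> mD mphi mh h_ge0 mD' Duv A mA.
pose nu : {measure set (measurableTypeR R) -> \bar R} :=
  pull_measure D phi h mD mphi mh h_ge0.
pose g (n : nat) : set (measurableTypeR R) := `](- n%:R), n%:R]%classic.
rewrite setIC; change (mrestr lebesgue_measure mD' A = nu A).
have g_cover : \bigcup_k g k = setT.
  rewrite -subTset => x _; exists (Num.truncn `|x|).+1 => //=.
  rewrite /g /= in_itv /=.
  have := Num.Theory.truncnS_gt `|x|; rewrite ltr_norml => /andP[-> /ltW ->] //.
apply: (@measure_unique _ R (measurableTypeR R) (@ocitv R) g _ _ _ g_cover
  (mrestr lebesgue_measure mD') nu) => //.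
- exact: ocitvI.
- by move=> i; exists (- i%:R, i%:R).
- move=> _ [[u v] _ <-] /=; rewrite /mrestr setIC.
  have [uv|vu] := leP u v; first exact: Duv.
  by rewrite set_itv_ge ?bnd_simp -?leNgt ?ltW// setI0 measure0 measure0.
- move=> k; rewrite /mrestr /=.
  apply: (@le_lt_trans _ _ (lebesgue_measure (g k))).
    have mg : measurable (g k) by exact: (@measurable_itv R `]- k%:R, k%:R]).
    by apply: le_measure; rewrite ?inE //; exact: (measurableI (g k) D' mg mD').
  by rewrite lebesgue_measure_itv /=; case: ifPn => // _; rewrite -EFinD ltry.
Qed.

(** * Monotone differentiable maps *)

Lemma integral_derive_segment {R : realType} (F f : R -> R) (a b s t : R) :
  (forall x, a <= x <= b -> is_derive x 1 F (f x)) ->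
  {within `[a, b], continuous f} ->
  a <= s -> s <= t -> t <= b ->
  (\int[lebesgue_measure]_(x in `[s, t]) (f x)%:E = (F t - F s)%:E)%E.
Proof.
move=> dF cf sa st tb.
have [->|nst] := eqVneq s t; first by rewrite set_itv1 integral_set1 subrr.
have {nst}st : s < t by rewrite lt_neqAle nst.
have dFst x : s <= x <= t -> is_derive x 1 F (f x).
  by move=> /andP[sx xt]; apply: dF; apply/andP; split; lra.
have cF x : s <= x <= t -> {for x, continuous F}.
  move=> /dFst dFx; apply/differentiable_continuous/derivable1_diffP.
  by case: dFx.
rewrite (@continuous_FTC2 R f F)//.
- apply: continuous_subspaceW cf; apply: subset_itv; rewrite ?bnd_simp //.
- split.
  + move=> x; rewrite in_itv /= => /andP[sx xt].
    by have [] : is_derive x 1 F (f x) by apply: dFst; rewrite !ltW.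
  + by apply: cvg_at_right_filter; apply: cF; rewrite lexx ltW.
  + by apply: cvg_at_left_filter; apply: cF; rewrite lexx ltW.
- move=> x; rewrite in_itv /= => /andP[sx xt].
  have [] : is_derive x 1 F (f x) by apply: dFst; rewrite !ltW.
  by rewrite derive1E.
Qed.

(** The preimage of [`]u, v]] is, up to its end points, the segment between
    the preimages [s] and [t] of [u] and [v] clamped to the range of [F];
    both measures then equal [F t - F s]. *)
Lemma transports_increasing {R : realType} (F f : R -> R) (a b : R) :
  a <= b ->
  (forall x, a <= x <= b -> is_derive x 1 F (f x)) ->
  {within `[a, b], continuous f} ->
  (forall x, a <= x <= b -> 0 <= f x) ->
  {in `[a, b] &, {homo F : x y / x < y}} ->
  transports `[a, b] F f `[F a, F b].
Proof.
move=> ab dF cf f_ge0 Flt.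
have cF : {within `[a, b], continuous F}.
  apply: derivable_within_continuous => x.
  by rewrite in_itv /= => /dF [].
have mf : measurable_fun `[a, b] f.
  exact: subspace_continuous_measurable_fun.
have mF : measurable_fun `[a, b] F.
  exact: subspace_continuous_measurable_fun.
have Flei x y : x \in `[a, b] -> y \in `[a, b] -> (F x <= F y) = (x <= y).
  exact: (le_mono_in Flt).
have Flti x y : x \in `[a, b] -> y \in `[a, b] -> (F x < F y) = (x < y).
  exact: (leW_mono_in (le_mono_in Flt)).
have aab : a \in `[a, b] by rewrite in_itv /= lexx.
have bab : b \in `[a, b] by rewrite in_itv /= lexx andbT.
have Fab : F a <= F b by rewrite Flei.
apply: transports_ocitv => // u v uv.
(* [cl] clamps to the range of [F], so that [cl u] and [cl v] have preimages *)
pose cl w : R := if w <= F a then F a else if F b <= w then F b else w.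
have clP w : F a <= cl w <= F b.
  rewrite /cl; case: (leP w (F a)) => wa; first by rewrite lexx.
  by case: (leP (F b) w) => bw; apply/andP; split; lra.
have Fcl w : exists2 x, x \in `[a, b] & F x = cl w.
  apply: IVT => //; have := clP w.
  by rewrite minElt maxElt; case: ifPn => ?; lra.
have [s sab Fs] := Fcl u; have [t tab Ft] := Fcl v.
have cl_le w y : F a <= y <= F b ->
    (w < y -> cl w <= y) /\ (y <= w -> y <= cl w).
  rewrite /cl => /andP[ay yb].
  case: (leP w (F a)) => wa; first by split; lra.
  by case: (leP (F b) w) => bw; split; lra.
have lt_cl w y : F a <= y <= F b ->
    (cl w < y -> w < y) /\ (y < cl w -> y <= w).
  rewrite /cl => /andP[ay yb].
  case: (leP w (F a)) => wa; first by split; lra.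
  by case: (leP (F b) w) => bw; split; lra.
have clt : cl u <= cl v.
  rewrite /cl.
  case: (leP u (F a)) => ua; case: (leP v (F a)) => va; try lra.
  - by case: (leP (F b) v) => bv; lra.
  - by case: (leP (F b) u) => bu; case: (leP (F b) v) => bv; lra.
have st : s <= t by rewrite -Flei// Fs Ft.
have [/andP[a_s sb] /andP[a_t tb]] : a <= s <= b /\ a <= t <= b.
  by move: sab tab; rewrite !in_itv.
have sub1 : `]s, t[ `<=` `[a, b] `&` F @^-1` `]u, v].
  move=> x /=; rewrite !in_itv /= => /andP[sx xt].
  have xab : x \in `[a, b] by rewrite in_itv /=; apply/andP; split; lra.
  have Fx : F a <= F x <= F b by rewrite !Flei// -in_itv.
  split; first by move: xab; rewrite in_itv.
  have : cl u < F x by rewrite -Fs Flti.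
  have : F x < cl v by rewrite -Ft Flti.
  by move=> /(lt_cl v _ Fx).2 -> /(lt_cl u _ Fx).1 ->.
have sub2 : `[a, b] `&` F @^-1` `]u, v] `<=` `[s, t].
  move=> x /= [xab]; rewrite !in_itv /= => /andP[uF Fv].
  have Fx : F a <= F x <= F b by rewrite !Flei// -in_itv.
  rewrite -[s <= x]Flei// -[x <= t]Flei// Fs Ft.
  by rewrite (cl_le u _ Fx).1 ?(cl_le v _ Fx).2.
have sub3 : `]F s, F t[ `<=` `[F a, F b] `&` `]u, v].
  move=> y /=; rewrite !in_itv /= Fs Ft => /andP[uy yv].
  have Fy : F a <= y <= F b.
    have /andP[? _] := clP u; have /andP[_ ?] := clP v.
    by apply/andP; split; lra.
  by split => //; rewrite (lt_cl u _ Fy).1 ?(lt_cl v _ Fy).2.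
have sub4 : `[F a, F b] `&` `]u, v] `<=` `[F s, F t].
  move=> y /= []; rewrite !in_itv /= Fs Ft => Fy /andP[uy yv].
  by rewrite (cl_le u _ Fy).1 ?(cl_le v _ Fy).2.
(* the sets of interest lie between open and closed intervals, which have
   the same measure and carry the same integral *)
have mI : measurable (`[a, b] `&` F @^-1` `]u, v]).
  by apply: mF => //; exact: measurable_itv.
have mst : measurable_fun `[s, t] f.
  apply: measurable_funS mf => //; apply: subset_itv; rewrite bnd_simp//.
have f_ge0' x : `[s, t]%classic x -> (0 <= (f x)%:E)%E.
  rewrite /= in_itv /= => /andP[sx xt]; rewrite lee_fin f_ge0//; lra.
transitivity ((F t - F s)%:E).
  apply/eqP; rewrite eq_le; apply/andP; split.
    apply: (@le_trans _ _ (lebesgue_measure (`[F s, F t] : set R))).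
      by apply: le_measure => //; rewrite inE //; exact: measurableI.
    rewrite lebesgue_measure_itv /= lte_fin.
    by case: ifPn => // _; rewrite lee_fin; lra.
  apply: (@le_trans _ _ (lebesgue_measure (`]F s, F t[ : set R))).
    rewrite lebesgue_measure_itv /= lte_fin.
    by case: ifPn => //; rewrite -leNgt lee_fin; lra.
  by apply: le_measure => //; rewrite inE //; exact: measurableI.
have FTC : (\int[lebesgue_measure]_(x in `[s, t]) (f x)%:E = (F t - F s)%:E)%E.
  exact: (@integral_derive_segment _ F f a b).
apply/eqP; rewrite eq_le; apply/andP; split; rewrite -FTC; last first.
  by apply: ge0_subset_integral => //; exact/measurable_EFinP.
rewrite -integral_itv_bndo_bndc; last first.
  apply/measurable_EFinP; apply: measurable_funS mst => //.
  by apply: subset_itvl; rewrite bnd_simp.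
rewrite -integral_itv_obnd_cbnd; last first.
  apply/measurable_EFinP; apply: measurable_funS mst => //.
  exact: subset_itv_oo_cc.
apply: ge0_subset_integral => //.
- by apply/measurable_EFinP; apply: measurable_funS mf => // x [].
- by move=> x [+ _]; rewrite /= in_itv /= lee_fin; exact: f_ge0.
Qed.

Lemma lebesgue_measure_oppr {R : realType} (A : set R) :
  measurable A -> lebesgue_measure (-%R @^-1` A) = lebesgue_measure A.
Proof.
move=> mA.
have mopp : measurable_fun [set: R] (-%R : R -> R) by exact: oppr_measurable.
have oc u v : u <= v -> lebesgue_measure ([set: R] `&` `]u, v]) =
    (\int[lebesgue_measure]_(x in [set: R] `&` -%R @^-1` `]u, v]) (1 : R)%:E)%E.
  move=> uv.
  have -> : [set: R] `&` -%R @^-1` `]u, v] = `[- v, - u[%classic.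
    rewrite setTI; apply/seteqP; split => x /=; rewrite !in_itv /=; lra.
  rewrite setTI integral_cst//= mul1e !lebesgue_measure_itv /= !lte_fin.
  by rewrite ltrN2 !EFinN oppeK addeC.
have := @transports_ocitv R setT setT -%R (cst 1) measurableT mopp
  (@measurable_cst _ _ _ _ _ _) (fun _ _ => ler01) measurableT oc A mA.
rewrite !setTI /= => ->; rewrite integral_cst ?mul1e //.
by rewrite -[X in measurable X]setTI; exact: mopp.
Qed.

(** Reflection reduces this to the increasing map [- F]. *)
Lemma transports_decreasing {R : realType} (F f : R -> R) (a b : R) :
  a <= b ->
  (forall x, a <= x <= b -> is_derive x 1 F (- f x)) ->
  {within `[a, b], continuous f} ->
  (forall x, a <= x <= b -> 0 <= f x) ->
  {in `[a, b] &, {homo F : x y /~ x < y}} ->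
  transports `[a, b] F f `[F b, F a].
Proof.
move=> ab dF cf f_ge0 Flt A mA.
have mNA : measurable (-%R @^-1` A).
  by rewrite -[X in measurable X]setTI; exact: oppr_measurable.
have tr : transports `[a, b] (\- F) f `[- F a, - F b].
  apply: transports_increasing => //.
  - by move=> x /dF dFx; have := is_deriveN dFx; rewrite opprK.
  - by move=> x y xab yab xy; rewrite ltrN2; exact: Flt.
rewrite -lebesgue_measure_oppr; last exact: (measurableI _ A).
have -> : -%R @^-1` (`[F b, F a] `&` A) = `[- F a, - F b] `&` -%R @^-1` A.
  by apply/seteqP; split=> x /=; rewrite !in_itv /= => -[? ?]; split => //; lra.
rewrite tr//.
by congr integral; apply/seteqP; split => x /=; rewrite opprK.
Qed.

(** Used to remove end points, where the Jacobian may vanish. *)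
Lemma transports_preimage {R : realType} (D D' D0 B : set R) (phi h : R -> R) :
  transports D phi h D' -> measurable B -> B `<=` D' ->
  (forall x, D0 x <-> D x /\ B (phi x)) -> transports D0 phi h B.
Proof.
move=> tr mB BD' D0E A mA.
have -> : D0 = D `&` phi @^-1` B by apply/seteqP; split => x /D0E.
by rewrite -[in LHS](setIidr BD') -!setIA tr//; exact: measurableI.
Qed.

(** Exhaustion of an unbounded domain. *)
Lemma transports_bigcup {R : realType} (D D' : (set R)^nat) (phi h : R -> R) :
  nondecreasing_seq D -> nondecreasing_seq D' ->
  (forall n, measurable (D n)) -> (forall n, measurable (D' n)) ->
  measurable_fun (\bigcup_n D n) phi -> measurable_fun (\bigcup_n D n) h ->
  (forall x, (\bigcup_n D n) x -> 0 <= h x) ->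
  (forall n, transports (D n) phi h (D' n)) ->
  transports (\bigcup_n D n) phi h (\bigcup_n D' n).
Proof.
move=> ndD ndD' mD mD' mphi mh h_ge0 tr A mA.
have mU : measurable (\bigcup_n D n) by exact: bigcupT_measurable.
have mDA n : measurable (D n `&` phi @^-1` A).
  by apply: (measurable_funS mU _ mphi) => //; exact: bigcup_sup.
rewrite !setI_bigcupl.
have cvgl : lebesgue_measure (D' n `&` A) @[n --> \oo] -->
    lebesgue_measure (\bigcup_n (D' n `&` A)).
  apply: nondecreasing_cvg_mu.
  - by move=> n; exact: (measurableI (D' n) A).
  - by apply: bigcupT_measurable => n; exact: (measurableI (D' n) A).
  - by move=> m n mn; apply/subsetPset; apply: setSI; exact/subsetPset/ndD'.
have cvgr : (\int[lebesgue_measure]_(x in D n `&` phi @^-1` A) (h x)%:E)%E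
    @[n --> \oo] -->
    (\int[lebesgue_measure]_(x in \bigcup_n (D n `&` phi @^-1` A)) (h x)%:E)%E.
  apply: ge0_nondecreasing_set_cvg_integral => //.
  - by move=> m n mn; apply/subsetPset; apply: setSI; exact/subsetPset/ndD.
  - move=> n; apply/measurable_EFinP; apply: measurable_funS mh => //.
    by move=> x [Dx _]; exists n.
  - by move=> n x [Dx _]; rewrite lee_fin h_ge0//; exists n.
apply: cvg_unique cvgl _ => //; apply: cvg_trans cvgr.
by apply: near_eq_cvg; near=> n; rewrite tr.
Unshelve. all: by end_near. Qed.

(** * Change of variables in integrals *)

Import HBNNSimple.

(** Simple functions are combinations of indicator functions, for which this
    is [transports]; monotone convergence on both sides does the rest. *)
Lemma transports_ge0_integral {R : realType} (D D' : set R) (phi h : R -> R)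
    (g : R -> \bar R) :
  measurable D -> measurable D' ->
  measurable_fun D phi -> measurable_fun D h ->
  (forall x, D x -> 0 <= h x) -> (forall x, D x -> D' (phi x)) ->
  transports D phi h D' ->
  measurable_fun D' g -> (forall y, D' y -> (0 <= g y)%E) ->
  (\int[lebesgue_measure]_(y in D') g y =
   \int[lebesgue_measure]_(x in D) (g (phi x) * (h x)%:E))%E.
Proof.
move=> mD mD' mphi mh h_ge0 phiD tr mg g_ge0.
pose g_ := nnsfun_approx mD' mg.
have mgphi n : measurable_fun D (g_ n \o phi).
  by apply: measurableT_comp => //; exact: measurable_funP.
have ge0g n y : 0 <= g_ n y by exact: fun_ge0.
have ndg m n y : (m <= n)%O -> g_ m y <= g_ n y.
  by move=> mn; have /lefP := nd_nnsfun_approx mD' mg mn; exact.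
have cvgg y : D' y -> EFin \o g_^~ y @ \oo --> g y.
  by move=> D'y; apply: cvg_nnsfun_approx => // z D'z; exact: g_ge0.
have -> : (\int[lebesgue_measure]_(y in D') g y =
    limn (fun n => \int[lebesgue_measure]_(y in D') (g_ n y)%:E))%E.
  rewrite -monotone_convergence//.
  - apply: eq_integral => y /[!inE] D'y; apply/esym/cvg_lim => //; exact: cvgg.
  - move=> n; apply/measurable_EFinP/measurable_funTS.
    exact: (measurable_funP (g_ n)).
  - by move=> n y _; rewrite lee_fin.
  - by move=> y _ m n mn; rewrite lee_fin; exact: ndg.
have -> : (\int[lebesgue_measure]_(x in D) (g (phi x) * (h x)%:E) =
    limn (fun n =>
      \int[lebesgue_measure]_(x in D) ((g_ n (phi x))%:E * (h x)%:E)))%E.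
  rewrite -monotone_convergence//.
  - apply: eq_integral => x /[!inE] Dx; apply/esym/cvg_lim => //.
    by apply: cvgeZr => //; exact/cvgg/phiD.
  - move=> n; apply: emeasurable_funM; apply/measurable_EFinP.
      exact: (mgphi n).
    exact: mh.
  - by move=> n x Dx; rewrite mule_ge0 ?lee_fin ?h_ge0 ?ge0g.
  - move=> x Dx m n mn; rewrite lee_wpmul2r ?lee_fin ?h_ge0//.
    exact: ndg.
congr (limn _); apply/funext => n.
transitivity (\int[lebesgue_measure]_(y in D')
   (\sum_(r \in range (g_ n)) (r * \1_(g_ n @^-1` [set r]) y)%:E))%E.
  by apply: eq_integral => t tE; rewrite /= fimfunE -fsumEFin.
have mind (E : set R) (mE : measurable E) (r : R) :
    measurable_fun E (fun y => (r * \1_(g_ n @^-1` [set r]) y)%:E).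
  by apply/measurable_EFinP; exact: measurable_funM.
rewrite ge0_integral_fsum//; last 2 first.
  - by move=> r; exact: mind.
  - by move=> r y _; exact: nnfun_muleindic_ge0.
transitivity (\int[lebesgue_measure]_(x in D) (\sum_(r \in range (g_ n))
    (r * \1_(g_ n @^-1` [set r]) (phi x))%:E * (h x)%:E))%E; last first.
  apply: eq_integral => x _.
  rewrite -ge0_mule_fsuml => [|y]; last exact: nnfun_muleindic_ge0.
  by rewrite fsumEFin // -(fimfunE _ (phi x)).
have mindphi r : measurable_fun D
    (fun x => (r * \1_(g_ n @^-1` [set r]) (phi x))%:E).
  apply/measurable_EFinP; apply: measurable_funM => //.
  exact: (@measurableT_comp _ _ _ _ _ _ (\1_(g_ n @^-1` [set r]) : R -> R)).
rewrite ge0_integral_fsum//; last 2 first.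
  - move=> r; apply: emeasurable_funM; first exact: mindphi.
    exact/measurable_EFinP.
  - move=> r x Dx; rewrite mule_ge0 ?lee_fin ?h_ge0// -lee_fin.
    exact: nnfun_muleindic_ge0.
apply: eq_fsbigr => r /[!inE] -[z _ zr].
have r_ge0 : 0 <= r by rewrite -zr.
have mr : measurable (g_ n @^-1` [set r]) by exact: measurable_sfunP.
under eq_integral do rewrite EFinM.
rewrite ge0_integralZl//; last exact/measurable_EFinP.
rewrite integral_indic// setIC [X in (_ * X)%E](tr _ mr).
under [RHS]eq_integral do rewrite EFinM -muleA.
rewrite ge0_integralZl//; last 2 first.
  - by apply: emeasurable_funM; apply/measurable_EFinP => //;
    exact: (@measurableT_comp _ _ _ _ _ _ (\1_(g_ n @^-1` [set r]) : R -> R)).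
  - by move=> x Dx; rewrite mule_ge0 ?lee_fin ?h_ge0 ?ge0g.
congr (_ * _)%E.
under [RHS]eq_integral do rewrite muleC.
rewrite [LHS]integral_mkcondr; apply: eq_integral => x _.
by rewrite epatch_indic.
Qed.

(** The inverse [psi] is there to transfer measurability from [D] back to
    [D']. *)
Record substitution {R : realType} (D D' : set R) (phi psi h : R -> R) : Prop :=
  Substitution {
    subst_mdom : measurable D;
    subst_mcod : measurable D';
    subst_mphi : measurable_fun D phi;
    subst_mpsi : measurable_fun D' psi;
    subst_mh : measurable_fun D h;
    subst_h_gt0 : forall x, D x -> 0 < h x;
    subst_phi : forall x, D x -> D' (phi x);
    subst_psi : forall y, D' y -> D (psi y);
    subst_psiK : forall y, D' y -> phi (psi y) = y;
    subst_transports : transports D phi h D'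
  }.

Arguments subst_mdom {R D D' phi psi h}.
Arguments subst_h_gt0 {R D D' phi psi h}.

Section substitution.
Context {R : realType} {D D' : set R} {phi psi h : R -> R}.
Hypothesis S : substitution D D' phi psi h.
Local Notation mu := (@lebesgue_measure R).

(** Conversely to composing with [phi], [g] is recovered on [D'] by composing
    with [psi] and dividing by the Jacobian. *)
Lemma substitution_measurable (g : R -> R) :
  measurable_fun D' g <-> measurable_fun D (fun x => g (phi x) * h x).
Proof.
case: S => mD mD' mphi mpsi mh h_gt0 phiD psiD psiK _.
split=> [mg|mgh].
  apply: measurable_funM => //; apply: (measurable_comp mD') mg _ => //.
  by move=> _ [x Dx <-]; exact: phiD.
have mV : measurable_fun D ((@GRing.inv R) \o h).
  refine (measurable_comp (measurable_itv `]0, +oo[) _ _ mh).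
    by move=> _ [x Dx <-]; rewrite /= in_itv /= h_gt0.
  apply: open_continuous_measurable_fun => // x /[!inE] /=.
  by rewrite in_itv /= andbT => x0; apply: inv_continuous; rewrite gt_eqF.
have := measurable_funM mgh mV.
move/(measurable_comp mD (g := psi) (E := D')) => m.
apply: eq_measurable_fun (m _ mpsi).
  move=> y /[!inE] D'y /=; rewrite mulfK ?psiK//.
  by rewrite gt_eqF//; exact/h_gt0/psiD.
by move=> _ [y D'y <-]; exact: psiD.
Qed.

Lemma substitution_ge0_integral (g : R -> \bar R) :
  measurable_fun D' g -> (forall y, D' y -> (0 <= g y)%E) ->
  (\int[mu]_(y in D') g y = \int[mu]_(x in D) (g (phi x) * (h x)%:E))%E.
Proof.
case: S => mD mD' mphi mpsi mh h_gt0 phiD psiD psiK tr.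
by apply: transports_ge0_integral => // x Dx; rewrite ltW// h_gt0.
Qed.

Lemma substitution_integrable (g : R -> R) :
  mu.-integrable D' (EFin \o g) <->
  mu.-integrable D (EFin \o (fun x => g (phi x) * h x)).
Proof.
have eqabs : measurable_fun D' g ->
    (\int[mu]_(y in D') `|(g y)%:E| =
     \int[mu]_(x in D) `|(g (phi x) * h x)%:E|)%E.
  move=> mg; rewrite substitution_ge0_integral//; last first.
    by apply: measurableT_comp => //; exact/measurable_EFinP.
  apply: eq_integral => x /[!inE] Dx.
  rewrite EFinM abseM [(`|(h x)%:E|)%E]gee0_abs//.
  by rewrite lee_fin ltW// (subst_h_gt0 S).
split=> /integrableP[/measurable_EFinP mg foo]; apply/integrableP; split.
- exact/measurable_EFinP/substitution_measurable.
- by rewrite /= -eqabs.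
- exact/measurable_EFinP/substitution_measurable.
- by rewrite /= eqabs//; exact/substitution_measurable.
Qed.

Lemma substitution_Rintegral (g : R -> R) : measurable_fun D' g ->
  \int[mu]_(y in D') g y = \int[mu]_(x in D) (g (phi x) * h x).
Proof.
move=> mg; congr fine; rewrite [LHS]integralE [RHS]integralE.
have mEg : measurable_fun D' (EFin \o g) by exact/measurable_EFinP.
congr (_ - _)%E.
  rewrite substitution_ge0_integral//; last exact: measurable_funepos.
  apply: eq_integral => x /[!inE] Dx.
  have hx : 0 <= h x by rewrite ltW// (subst_h_gt0 S).
  by rewrite /= !funeposE -!EFin_max -EFinM maxr_pMl// mul0r.
rewrite substitution_ge0_integral//; last exact: measurable_funeneg.
apply: eq_integral => x /[!inE] Dx.
have hx : 0 <= h x by rewrite ltW// (subst_h_gt0 S).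
by rewrite /= !funenegE -!EFinN -!EFin_max -EFinM maxr_pMl// mul0r mulNr.
Qed.

End substitution.

(** * Integrals of complex functions *)

Section complex_integral.
Context {R : realType}.
Implicit Types (D : set R) (f g : R -> R[i]).

Lemma eq_cintegrable D f g : measurable D -> {in D, f =1 g} ->
  cintegrable D f <-> cintegrable D g.
Proof.
move=> mD; suff imp u v : {in D, u =1 v} -> cintegrable D u -> cintegrable D v.
  by move=> fg; split; apply: imp => // x xD; rewrite fg.
move=> uv [Iu Ju]; split; [move: Iu|move: Ju]; apply: eq_integrable => // x xD;
by rewrite uv.
Qed.

Lemma eq_cintegral D f g : measurable D -> {in D, f =1 g} ->
  cintegral D f = cintegral D g.
Proof.
move=> mD fg; rewrite /cintegral (asbool_equiv_eq (eq_cintegrable D f g mD fg)).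
by case: ifP => // _; congr (_ +i* _); apply: eq_Rintegral => x xD; rewrite fg.
Qed.

Lemma cintegrableZ D (k : R[i]) f : measurable D ->
  cintegrable D f -> cintegrable D (fun x => k * f x).
Proof.
case: k => kr ki mD [/= If Jf]; split.
  have -> : (fun x => (Re ((kr +i* ki) * f x))%:E) =
      ((fun x => kr%:E * (Re (f x))%:E) \- (fun x => ki%:E * (Im (f x))%:E))%E.
    by apply/funext => x; case: (f x).
  by apply: integrableB => //; exact: integrableZl.
have -> : (fun x => (Im ((kr +i* ki) * f x))%:E) =
    ((fun x => kr%:E * (Im (f x))%:E) \+ (fun x => ki%:E * (Re (f x))%:E))%E.
  apply/funext => x; case: (f x) => a b /=.
  by rewrite -!EFinM -EFinD; congr EFin; ring.
by apply: integrableD => //; exact: integrableZl.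
Qed.

Lemma cintegrableZ_iff D (k : R[i]) f : measurable D -> k != 0 ->
  cintegrable D (fun x => k * f x) <-> cintegrable D f.
Proof.
move=> mD k0; split; last exact: cintegrableZ.
move=> /(cintegrableZ D k^-1 _ mD); apply: (eq_cintegrable _ _ _ mD _).1 => x _.
by rewrite mulKf.
Qed.

Lemma integrableMl D (r : R) (u : R -> R) : measurable D ->
  lebesgue_measure.-integrable D (EFin \o u) ->
  lebesgue_measure.-integrable D (EFin \o (fun x => r * u x)).
Proof.
by move=> mD iu; apply: eq_integrable (integrableZl _ r iu).
Qed.

(** For a nonzero [k] the two sides are integrable simultaneously, so the
    convention for divergent integrals is respected. *)
Lemma cintegralZ D (k : R[i]) f : measurable D -> k != 0 ->
  cintegral D (fun x => k * f x) = k * cintegral D f.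
Proof.
move=> mD k0; rewrite /cintegral.
rewrite (asbool_equiv_eq (cintegrableZ_iff D k f mD k0)).
case: asboolP => [[If Jf]|_]; last by rewrite mulr0.
case: k k0 => kr ki _.
apply/eqP; rewrite eq_complex /=; apply/andP; split; apply/eqP.
  rewrite -(@RintegralZl _ _ _ lebesgue_measure D (fun x => Re (f x)) kr mD If).
  rewrite -(@RintegralZl _ _ _ lebesgue_measure D (fun x => Im (f x)) ki mD Jf).
  rewrite -RintegralB//; [|exact: (@integrableMl _ kr _ mD If)|
    exact: (@integrableMl _ ki _ mD Jf)].
  by apply: eq_Rintegral => x _; case: (f x).
rewrite -(@RintegralZl _ _ _ lebesgue_measure D (fun x => Im (f x)) kr mD Jf).
rewrite -(@RintegralZl _ _ _ lebesgue_measure D (fun x => Re (f x)) ki mD If).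
rewrite -RintegralD//; [|exact: (@integrableMl _ kr _ mD Jf)|
  exact: (@integrableMl _ ki _ mD If)].
by apply: eq_Rintegral => x _; case: (f x).
Qed.

Lemma substitution_cintegrable D D' phi psi h f :
  substitution D D' phi psi h ->
  cintegrable D' f <-> cintegrable D (fun x => f (phi x) * (h x)%:C).
Proof.
move=> S.
have ReM x : Re (f (phi x) * (h x)%:C) = Re (f (phi x)) * h x.
  by case: (f _) => a b /=; rewrite mulr0 subr0.
have ImM x : Im (f (phi x) * (h x)%:C) = Im (f (phi x)) * h x.
  by case: (f _) => a b /=; rewrite mulr0 add0r.
rewrite /cintegrable.
under [X in _ <-> (lebesgue_measure.-integrable _ X /\ _)]eq_fun do rewrite ReM.
under [X in _ <-> (_ /\ lebesgue_measure.-integrable _ X)]eq_fun do rewrite ImM.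
have HR := substitution_integrable S (fun y => Re (f y)).
have HI := substitution_integrable S (fun y => Im (f y)).
by split=> -[/HR ? /HI ?].
Qed.

Lemma substitution_cintegral D D' phi psi h f :
  substitution D D' phi psi h ->
  cintegral D' f = cintegral D (fun x => f (phi x) * (h x)%:C).
Proof.
move=> S; rewrite /cintegral.
rewrite (asbool_equiv_eq (substitution_cintegrable D D' phi psi h f S)).
case: asboolP => // /(substitution_cintegrable _ _ _ _ _ _ S).
move=> [/integrableP[/measurable_EFinP mR _]].
move=> /integrableP[/measurable_EFinP mI _].
rewrite (substitution_Rintegral S _ mR) (substitution_Rintegral S _ mI).
congr (_ +i* _); apply: eq_Rintegral => x _; case: (f _) => a b /=.
  by rewrite mulr0 subr0.
by rewrite mulr0 add0r.
Qed.

End complex_integral.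

(** The form in which a change of variables is applied below: the integrands
    match up to a constant factor [k]. *)
Lemma substitution_cintegral_scaled {R : realType} (D D' : set R)
    (phi psi h : R -> R) (f g : R -> R[i]) (k : R[i]) :
  substitution D D' phi psi h -> k != 0 ->
  (forall x, D x -> f (phi x) * (h x)%:C = k * g x) ->
  cintegral D' f = k * cintegral D g /\
  (cintegrable D' f <-> cintegrable D g).
Proof.
move=> S k0 fg; have mD := subst_mdom S.
have fg' : {in D, (fun x => f (phi x) * (h x)%:C) =1 (fun x => k * g x)}.
  by move=> x /[!inE] Dx; exact: fg.
split.
  rewrite (substitution_cintegral _ _ _ _ _ f S).
  by rewrite (eq_cintegral _ _ _ mD fg') cintegralZ.
apply: iff_trans (substitution_cintegrable _ _ _ _ _ f S) _.
apply: iff_trans (eq_cintegrable _ _ _ mD fg') _.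
exact: cintegrableZ_iff.
Qed.

(** * Complex powers of a positive base *)

Section complex_power.
Context {R : realType}.
Implicit Types (x y : R) (z w : R[i]).

Lemma cexpD z w : cexp (z + w) = cexp z * cexp w.
Proof.
case: z w => [a b] [c d]; rewrite /cexp /= expRD cosD sinD.
by apply/eqP; rewrite eq_complex /=; apply/andP; split; apply/eqP; ring.
Qed.

Lemma cexp_real x : cexp x%:C = (expR x)%:C.
Proof. by rewrite /cexp /= cos0 sin0 mulr1 mulr0. Qed.

Lemma rcpowD x z w : rcpow x (z + w) = rcpow x z * rcpow x w.
Proof. by rewrite /rcpow mulrDl cexpD. Qed.

Lemma rcpow0 x : rcpow x 0 = 1.
Proof. by rewrite /rcpow mul0r cexp_real expR0. Qed.

Lemma rcpow_neq0 x z : rcpow x z != 0.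
Proof.
have xz : rcpow x z * rcpow x (- z) = 1 by rewrite -rcpowD subrr rcpow0.
by apply: contra_eq_neq xz => ->; rewrite mul0r eq_sym oner_eq0.
Qed.

Lemma rcpowN x z : rcpow x (- z) = (rcpow x z)^-1.
Proof.
apply: (mulfI (rcpow_neq0 x z)).
by rewrite -rcpowD subrr rcpow0 divff// rcpow_neq0.
Qed.

Lemma rcpow1 x : 0 < x -> rcpow x 1 = x%:C.
Proof. by move=> x0; rewrite /rcpow mul1r cexp_real lnK. Qed.

Lemma rcpowM x y z : 0 < x -> 0 < y -> rcpow (x * y) z = rcpow x z * rcpow y z.
Proof. by move=> x0 y0; rewrite /rcpow lnM// rmorphD mulrDr cexpD. Qed.

Lemma rcpowV x z : 0 < x -> rcpow x^-1 z = (rcpow x z)^-1.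
Proof. by move=> x0; rewrite -rcpowN /rcpow lnV// rmorphN mulrN mulNr. Qed.

End complex_power.

Lemma one_rcpow {R : realType} (z : R[i]) : rcpow (1 : R) z = 1.
Proof. by rewrite /rcpow ln1 mulr0 cexp_real expR0. Qed.

Lemma powRV {R : realType} (x s : R) : 0 <= x -> x^-1 `^ s = (x `^ s)^-1.
Proof. by move=> x0; rewrite -powR_inv1// -powRrM mulN1r powRN. Qed.

(** * The three substitutions *)

Lemma substitution_affine {R : realType} (a c : R) : a < c ->
  substitution `]a, c[ `]0, 1[ (fun u => (u - a) / (c - a))
    (fun y => a + (c - a) * y) (fun=> (c - a)^-1).
Proof.
move=> ac; have ca : 0 < c - a by rewrite subr_gt0.
have cV : 0 < (c - a)^-1 by rewrite invr_gt0.
split => //.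
- by apply: measurable_funM => //; exact: measurable_funB.
- by apply: measurable_funD => //; exact: measurable_funM.
- move=> x /=; rewrite !in_itv /= => /andP[ax xc].
  by rewrite divr_gt0 ?subr_gt0//= ltr_pdivrMr// mul1r; lra.
- move=> y /=; rewrite !in_itv /= => /andP[y0 y1].
  by apply/andP; split; nra.
- by move=> y _ /=; field; rewrite gt_eqF.
pose F u : R := (c - a)^-1 *: (u - a).
have -> : (fun u => (u - a) / (c - a)) = F.
  by apply/funext => u; rewrite /F /GRing.scale /= mulrC.
have tr : transports `[a, c] F (fun=> (c - a)^-1) `[F a, F c].
  apply: transports_increasing.
  - exact: ltW.
  - move=> x _; apply: is_derive_eq.
    by rewrite /GRing.scale /=; ring.
  - by move=> x; exact: cst_continuous.
  - by move=> *; exact: ltW.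
  - by move=> x y _ _ xy; rewrite /F /GRing.scale /= ltr_pM2l// ltrD2r.
have Fa : F a = 0 by rewrite /F subrr scaler0.
have Fc : F c = 1 by rewrite /F /GRing.scale /= mulVf// gt_eqF.
rewrite Fa Fc in tr.
apply: transports_preimage tr _ _ _ => //.
  exact: subset_itv_oo_cc.
move=> x /=; rewrite !in_itv /= /F /GRing.scale /=.
rewrite pmulr_rgt0// subr_gt0 mulrC ltr_pdivrMr// mul1r ltrD2r.
by split; [move=> /andP[/[dup] /ltW -> -> /[dup] /ltW -> ->]|case].
Qed.

(** The map is transported on the closed quarter period, where [cos] is
    strictly decreasing, and then restricted to the interior. *)
Lemma substitution_cos2 {R : realType} :
  substitution `]0, (pi / 2)[ `]0, 1[ (fun t : R => cos t ^+ 2)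
    (fun y => acos (Num.sqrt y)) (fun t => 2 * (cos t * sin t)).
Proof.
have pi2 : 0 < pi / 2 :> R by rewrite divr_gt0// pi_gt0.
have cs0 (t : R) : 0 < t < pi / 2 -> 0 < cos t /\ 0 < sin t.
  move=> /[dup] /andP[t0 tpi] tI; split; last exact: sin_gt0_pihalf.
  by apply: cos_gt0_pihalf; rewrite tpi andbT; lra.
have cos_lt (x y : R) : 0 <= x -> y <= pi / 2 -> x < y -> cos y < cos x.
  move=> x0 ypi xy; have pp := pi_gt0 R.
  by rewrite ltr_cos// in_itv /=; apply/andP; split; lra.
have cos2 (x : R) : 0 <= x <= pi / 2 -> 0 <= cos x.
  by move=> /andP[? ?]; apply: cos_ge0_pihalf; apply/andP; split; lra.
have sqrtI (y : R) : 0 < y < 1 -> 0 < Num.sqrt y < 1.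
  by move=> /andP[y0 y1]; rewrite sqrtr_gt0 y0 -[ltRHS]sqrtr1 ltr_sqrt.
split => //.
- apply: measurable_funTS; apply: continuous_measurable_fun => x.
  apply: (@continuous_comp _ _ _ (@cos R) (fun z => z ^+ 2)).
    exact: continuous_cos.
  exact: exprn_continuous.
- apply: open_continuous_measurable_fun => // y /[!inE] /=.
  rewrite in_itv /= => /sqrtI/andP[s0 s1].
  apply: continuous_comp; first exact: sqrt_continuous.
  by apply: continuous_acos; rewrite s1 andbT; lra.
- apply: measurable_funTS; apply: continuous_measurable_fun => x.
  apply: cvgM; first exact: cvg_cst.
  by apply: cvgM; [exact: continuous_cos|exact: continuous_sin].
- move=> x /=; rewrite in_itv /= => /cs0[? ?].
  by rewrite !mulr_gt0.
- move=> x /=; rewrite !in_itv /= => /[dup] /andP[x0 xpi] /cs0[c0 s0].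
  rewrite exprn_gt0//= expr_lt1// ?ltW//.
  by rewrite -cos0 cos_lt// ltW.
- move=> y /=; rewrite !in_itv /= => /sqrtI/andP[s0 s1].
  have sI : -1 <= Num.sqrt y < 1 by apply/andP; split; lra.
  have sI' : -1 <= Num.sqrt y <= 1 by apply/andP; split; lra.
  rewrite acos_gt0//= -ltr_cos ?in_itv /= ?acos_ge0 ?acos_lepi//.
    by rewrite acosK ?in_itv// cos_pihalf.
  by have := pi_gt0 R; move=> ?; apply/andP; split; lra.
- move=> y /=; rewrite in_itv /= => yI; have /andP[s0 s1] := sqrtI y yI.
  have /andP[y0 y1] := yI.
  rewrite acosK; first by rewrite sqr_sqrtr// ltW.
  by rewrite in_itv /=; apply/andP; split; lra.
have tr : transports `[0, pi / 2] (fun t : R => cos t ^+ 2)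
    (fun t => 2 * (cos t * sin t)) `[cos (pi / 2) ^+ 2, cos 0 ^+ 2].
  apply: transports_decreasing.
  - exact: ltW.
  - move=> x _.
    have -> : (fun t : R => cos t ^+ 2) = cos ^+ 2 by [].
    apply: is_derive_eq; rewrite /GRing.scale /=; ring.
  - apply: continuous_subspaceT => x.
    apply: cvgM; first exact: cvg_cst.
    by apply: cvgM; [exact: continuous_cos|exact: continuous_sin].
  - move=> x /[dup] /cos2 c0 /andP[x0 xpi]; rewrite !mulr_ge0//.
    by apply: sin_ge0_pi; rewrite x0; have := pi_gt0 R; lra.
  - move=> x y; rewrite !in_itv /= => xI yI xy.
    rewrite ltr_pXn2r ?nnegrE ?cos2//.
    by apply: cos_lt => //; [case/andP: yI|case/andP: xI].
rewrite cos_pihalf cos0 expr0n expr1n /= in tr.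
apply: transports_preimage tr _ _ _ => //.
  exact: subset_itv_oo_cc.
move=> x /=; rewrite !in_itv /=; split.
  move=> /[dup] /andP[x0 xpi] /cs0[c0 s0]; rewrite !ltW//=; split => //.
  rewrite exprn_gt0//= expr_lt1// ?ltW//.
  by rewrite -cos0 cos_lt// ltW.
move=> [/andP[x0 xpi] /andP[c0 c1]]; rewrite !lt_neqAle x0 xpi !andbT.
apply/andP; split; apply/eqP => xE.
  by rewrite -xE cos0 expr1n ltxx in c1.
by rewrite xE cos_pihalf expr0n ltxx in c0.
Qed.

(** [u / (1 + u)] is written [1 - (1 + u)^-1], which makes its monotonicity
    and its derivative immediate. *)
Lemma substitution_ratio {R : realType} :
  substitution `]0, +oo[ `]0, 1[ (fun u : R => 1 - (1 + u)^-1)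
    (fun y => y / (1 - y)) (fun u => (1 + u) ^- 2).
Proof.
have mphi : measurable_fun (`[0, +oo[ : set R) (fun u : R => 1 - (1 + u)^-1).
  apply: subspace_continuous_measurable_fun => //.
  apply: continuous_in_subspaceT => x; rewrite inE /= in_itv /= andbT => x0.
  apply: cvgB; first exact: cvg_cst.
  apply: continuousV; first by rewrite gt_eqF//; lra.
  by apply: cvgD; [exact: cvg_cst|exact: cvg_id].
have mh : measurable_fun (`[0, +oo[ : set R) (fun u : R => (1 + u) ^- 2).
  apply: subspace_continuous_measurable_fun => //.
  apply: continuous_in_subspaceT => x; rewrite inE /= in_itv /= andbT => x0.
  apply: (@cvgV _ _ _ _ (fun u : R => (1 + u) ^+ 2)).
    by rewrite gt_eqF// exprn_gt0//; lra.
  apply: (@continuous_comp _ _ _ (fun u : R => 1 + u) (fun z => z ^+ 2));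
    last exact: exprn_continuous.
  by apply: cvgD; [exact: cvg_cst|exact: cvg_id].
have subo : `]0, +oo[ `<=` (`[0, +oo[ : set R).
  by move=> x /=; rewrite !in_itv /= !andbT; exact: ltW.
split => //.
- exact: measurable_funS mphi.
- apply: open_continuous_measurable_fun => // y /[!inE] /=.
  rewrite in_itv /= => /andP[y0 y1].
  apply: cvgM; first exact: cvg_id.
  apply: (@cvgV _ _ _ _ (fun u : R => 1 - u)).
    by rewrite gt_eqF// subr_gt0.
  by apply: cvgB; [exact: cvg_cst|exact: cvg_id].
- exact: measurable_funS mh.
- move=> x /=; rewrite in_itv /= andbT => x0.
  by rewrite invr_gt0 exprn_gt0//; lra.
- move=> x /=; rewrite !in_itv /= andbT => x0.
  have x1 : 0 < 1 + x by lra.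
  by rewrite subr_gt0 invf_lt1// ltrDl x0 gtrBl invr_gt0.
- move=> y /=; rewrite !in_itv /= andbT => /andP[y0 y1].
  by rewrite divr_gt0// subr_gt0.
- move=> y /=; rewrite in_itv /= => /andP[y0 y1].
  by field; lra.
pose F (u : R) : R := 1 - (1 + u)^-1.
have F0 : F 0 = 0 by rewrite /F addr0 invr1 subrr.
have tr n : transports `[0, n%:R] F (fun u => (1 + u) ^- 2) `[F 0, F n%:R].
  apply: transports_increasing.
  - exact: ler0n.
  - move=> x /andP[x0 xn].
    have x1 : 1 + x != 0 by rewrite gt_eqF//; lra.
    have dV : is_derive x 1 (fun u : R => (1 + u)^-1) (- (1 + x) ^- 2).
      apply: DeriveDef; first exact: derivableV.
      by rewrite deriveV// derive_val /GRing.scale /= add0r mulr1.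
    have := is_deriveB (is_derive_cst (1 : R) x 1) dV; rewrite sub0r opprK.
    exact.
  - apply: continuous_in_subspaceT => x.
    rewrite inE /= in_itv /= => /andP[x0 _].
    apply: (@cvgV _ _ _ _ (fun u : R => (1 + u) ^+ 2)).
    by rewrite gt_eqF// exprn_gt0//; lra.
    apply: (@continuous_comp _ _ _ (fun u : R => 1 + u) (fun z => z ^+ 2));
    last exact: exprn_continuous.
  by apply: cvgD; [exact: cvg_cst|exact: cvg_id].
  - by move=> x /andP[x0 _]; rewrite invr_ge0 exprn_ge0//; lra.
  - move=> x y; rewrite !in_itv /= => /andP[x0 _] /andP[y0 _] xy.
    by rewrite /F ltrD2l ltrN2 ltf_pV2 ?posrE; lra.
have itvU : `[0, +oo[%classic = \bigcup_n `[0, n%:R : R]%classic.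
  apply/seteqP; split => x; rewrite /= in_itv /= ?andbT.
    move=> x0; exists (Num.truncn x).+1 => //=; rewrite in_itv /= x0/=.
    exact/ltW/Num.Theory.truncnS_gt.
  by move=> [n _]; rewrite /= in_itv /= => /andP[].
have {}tr : transports (`[0, +oo[ : set R) F (fun u => (1 + u) ^- 2)
    (\bigcup_n `[F 0, F n%:R]%classic).
  rewrite itvU; apply: transports_bigcup => //; rewrite -?itvU//.
  - move=> m n mn; apply/subsetPset; apply: subset_itvl; rewrite bnd_simp.
    by rewrite ler_nat.
  - move=> m n mn; apply/subsetPset; apply: subset_itvl; rewrite bnd_simp.
    by rewrite /F lerD2l lerN2 lef_pV2 ?posrE ?lerD2l ?ler_nat//.
  - by move=> x _; rewrite invr_ge0 exprn_even_ge0.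
apply: transports_preimage tr _ _ _ => //.
  move=> y /=; rewrite in_itv /= => /andP[y0 y1].
  exists (Num.truncn (y / (1 - y))).+1 => //=; rewrite in_itv /= F0 ltW//=.
  have := Num.Theory.truncnS_gt (y / (1 - y)).
  set n := _.+1; rewrite ltr_pdivrMr ?subr_gt0// => yn.
  have n0 : (0 : R) <= n%:R by exact: ler0n.
  rewrite /F lerBrDr -lerBrDl -[leLHS]mul1r ler_pdivrMr; last by lra.
  by nra.
move=> x /=; rewrite !in_itv /= !andbT /F; split.
  move=> x0; rewrite ltW//; split => //.
  have x1 : 0 < 1 + x by lra.
  by rewrite subr_gt0 invf_lt1// ltrDl x0 gtrBl invr_gt0.
move=> [x0 /andP[x1 _]]; rewrite lt_neqAle x0 andbT; apply/eqP => xE.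
by rewrite -xE addr0 invr1 subrr ltxx in x1.
Qed.

(** * The integrand under the substitutions *)

Section extended_beta.
Context {R : realType} (lambda sigma tau : R) (p q eta1 eta2 : R[i]).
Local Notation E := (mittag_leffler lambda).
Local Notation f0 := (ext_beta_integrand lambda sigma tau p q eta1 eta2).

(** The common source of all the transformed integrands: at [t = x / (x + y)]
    one has [1 - t = y / (x + y)], and the powers of [x + y] collect. *)
Lemma ext_beta_integrand_ratio (x y : R) : 0 < x -> 0 < y ->
  f0 (x / (x + y)) =
  rcpow x (eta1 - 1) * rcpow y (eta2 - 1) * rcpow (x + y) (2 - eta1 - eta2)
  * E (- (p * ((x + y) `^ sigma)%:C / (x `^ sigma)%:C))
  * E (- (q * ((x + y) `^ tau)%:C / (y `^ tau)%:C)).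
Proof.
move=> x0 y0; have w0 : 0 < x + y by exact: addr_gt0.
have wV : 0 < (x + y)^-1 by rewrite invr_gt0.
rewrite /ext_beta_integrand.
have -> : 1 - x / (x + y) = y / (x + y) by field; rewrite gt_eqF.
have divE r (z s : R) : 0 < z ->
    r / ((z / (x + y)) `^ s)%:C = r * ((x + y) `^ s)%:C / (z `^ s)%:C.
  move=> z0; rewrite powRM ?powRV ?ltW// rmorphM fmorphV invfM invrK.
  by rewrite [X in r * X]mulrC mulrA.
rewrite !divE// !rcpowM// !rcpowV// -!rcpowN.
have -> : 2 - eta1 - eta2 = - (eta1 - 1) + - (eta2 - 1) :> R[i] by ring.
by rewrite (rcpowD (x + y)); ring.
Qed.

(** The ratio [x / (x + y)] for [x = cos t ^+ 2] and [y = sin t ^+ 2], whose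
    sum is [1]. *)
Lemma ext_beta_integrand_cos2 (t : R) : 0 < cos t -> 0 < sin t ->
  f0 (cos t ^+ 2) * (2 * (cos t * sin t))%:C =
  2 * (rcpow (cos t) (2 * eta1 - 1) * rcpow (sin t) (2 * eta2 - 1)
    * E (- (p / (cos t `^ (2 * sigma))%:C))
    * E (- (q / (sin t `^ (2 * tau))%:C))).
Proof.
move=> c0 s0; have [c2 s2] : 0 < cos t ^+ 2 /\ 0 < sin t ^+ 2.
  by rewrite !exprn_gt0.
have powR2 (x s : R) : 0 < x -> (x ^+ 2) `^ s = x `^ (2 * s).
  by move=> x0; rewrite powRrM powR_mulrn// ltW.
have rcpow2 (x : R) z : 0 < x ->
    rcpow x (2 * z - 1) = rcpow (x ^+ 2) (z - 1) * x%:C.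
  move=> x0; rewrite expr2 rcpowM// -rcpow1// -!rcpowD; congr rcpow; ring.
have -> : cos t ^+ 2 = cos t ^+ 2 / (cos t ^+ 2 + sin t ^+ 2).
  by rewrite cos2Dsin2 divr1.
rewrite ext_beta_integrand_ratio// cos2Dsin2 one_rcpow !powR1 !mulr1 !powR2//.
by rewrite !rcpow2// !rmorphM /= [2%:C]rmorph_nat; ring.
Qed.

(** The ratio [x / (x + y)] for [x = u] and [y = 1]. *)
Lemma ext_beta_integrand_line (u : R) : 0 < u ->
  f0 (1 - (1 + u)^-1) * ((1 + u) ^- 2)%:C =
  1 * (rcpow u (eta1 - 1) / rcpow (1 + u) (eta1 + eta2)
    * E (- (p * ((1 + u) `^ sigma)%:C / (u `^ sigma)%:C))
    * E (- (q * ((1 + u) `^ tau)%:C))).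
Proof.
move=> u0; have w0 : 0 < 1 + u by rewrite addr_gt0.
have -> : 1 - (1 + u)^-1 = u / (u + 1) by field; rewrite gt_eqF//; lra.
rewrite ext_beta_integrand_ratio// [u + 1]addrC one_rcpow powR1.
rewrite divr1 mul1r mulr1.
have -> : ((1 + u) ^- 2)%:C = rcpow (1 + u) (- 1 - 1).
  by rewrite rcpowD rcpowN rcpow1// -fmorphV -rmorphM -invfM.
rewrite -rcpowN.
have -> : - (eta1 + eta2) = (2 - eta1 - eta2) + (- 1 - 1) :> R[i] by ring.
by rewrite (rcpowD _ (2 - eta1 - eta2)); ring.
Qed.

Lemma ext_beta_integrand_affine (x y w : R) : 0 < x -> 0 < y -> x + y = w ->
  f0 (x / w) * (w^-1)%:C =
  rcpow w (1 - eta1 - eta2) *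
   (rcpow x (eta1 - 1) * rcpow y (eta2 - 1)
    * E (- (p * (w `^ sigma)%:C / (x `^ sigma)%:C))
    * E (- (q * (w `^ tau)%:C / (y `^ tau)%:C))).
Proof.
move=> x0 y0 <-; have w0 : 0 < x + y by exact: addr_gt0.
have -> : ((x + y)^-1)%:C = rcpow (x + y) (- 1).
  by rewrite rcpowN rcpow1// -fmorphV.
rewrite ext_beta_integrand_ratio//.
have -> : 1 - eta1 - eta2 = (2 - eta1 - eta2) + - 1 :> R[i] by ring.
by rewrite (rcpowD _ (2 - eta1 - eta2)); ring.
Qed.

End extended_beta.

Theorem theorem2 (R : realType) (lambda sigma tau : R)
    (eta1 eta2 p q : R[i]) (a c : R)
    (lambda_gt0 : 0 < lambda) (sigma_gt0 : 0 < sigma) (tau_gt0 : 0 < tau)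
    (eta1_gt0 : 0 < Re eta1) (eta2_gt0 : 0 < Re eta2)
    (hpq : (0 < Re p /\ 0 < Re q) \/
           [/\ Im p = 0, Im q = 0, 0 <= Re p & 0 <= Re q])
    (lt_ac : a < c) :
  let E := mittag_leffler lambda in
  let B := ext_beta lambda sigma tau p q eta1 eta2 in
  let f0 := ext_beta_integrand lambda sigma tau p q eta1 eta2 in
  let f1 := fun theta : R =>
    rcpow (cos theta) (2 * eta1 - 1) * rcpow (sin theta) (2 * eta2 - 1)
    * E (- (p / (cos theta `^ (2 * sigma))%:C))
    * E (- (q / (sin theta `^ (2 * tau))%:C)) in
  let f2 := fun u : R =>
    rcpow u (eta1 - 1) / rcpow (1 + u) (eta1 + eta2)
    * E (- (p * ((1 + u) `^ sigma)%:C / (u `^ sigma)%:C))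
    * E (- (q * ((1 + u) `^ tau)%:C)) in
  let f3 := fun u : R =>
    rcpow (1 + u) (eta1 - 1) * rcpow (1 - u) (eta2 - 1)
    * E (- ((2 `^ sigma)%:C * p / ((1 + u) `^ sigma)%:C))
    * E (- ((2 `^ tau)%:C * q / ((1 - u) `^ tau)%:C)) in
  let f4 := fun u : R =>
    rcpow (u - a) (eta1 - 1) * rcpow (c - u) (eta2 - 1)
    * E (- (p * ((c - a) `^ sigma)%:C / ((u - a) `^ sigma)%:C))
    * E (- (q * ((c - a) `^ tau)%:C / ((c - u) `^ tau)%:C)) in
  [/\ B = 2 * cintegral `]0, (pi / 2)[ f1,
      B = cintegral `]0, +oo[ f2,
      B = rcpow 2 (1 - eta1 - eta2) * cintegral `](-1), 1[ f3
    & B = rcpow (c - a) (1 - eta1 - eta2) * cintegral `]a, c[ f4]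
  /\
  [/\ cintegrable `]0, 1[ f0 <-> cintegrable `]0, (pi / 2)[ f1,
      cintegrable `]0, 1[ f0 <-> cintegrable `]0, +oo[ f2,
      cintegrable `]0, 1[ f0 <-> cintegrable `](-1), 1[ f3
    & cintegrable `]0, 1[ f0 <-> cintegrable `]a, c[ f4].
Proof.
move=> E B f0 f1 f2 f3 f4.
have two_neq0 : 2 != 0 :> R[i] by rewrite pnatr_eq0.
have [B1 I1] : B = 2 * cintegral `]0, (pi / 2)[ f1 /\
    (cintegrable `]0, 1[ f0 <-> cintegrable `]0, (pi / 2)[ f1).
  apply: substitution_cintegral_scaled substitution_cos2 two_neq0 _ => t.
  rewrite /= in_itv /= => /andP[t0 tpi].
  apply: ext_beta_integrand_cos2; last by rewrite sin_gt0_pihalf// t0.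
  by apply: cos_gt0_pihalf; rewrite tpi andbT; lra.
have [B2 I2] : B = 1 * cintegral `]0, +oo[ f2 /\
    (cintegrable `]0, 1[ f0 <-> cintegrable `]0, +oo[ f2).
  apply: substitution_cintegral_scaled substitution_ratio (oner_neq0 _) _ => u.
  by rewrite /= in_itv /= andbT; exact: ext_beta_integrand_line.
have [B3 I3] : B = rcpow 2 (1 - eta1 - eta2) * cintegral `](-1), 1[ f3 /\
    (cintegrable `]0, 1[ f0 <-> cintegrable `](-1), 1[ f3).
  have lt11 : - 1 < 1 :> R by lra.
  apply: substitution_cintegral_scaled (substitution_affine _ _ lt11)
    (rcpow_neq0 _ _) _ => u.
  rewrite /= in_itv /= => /andP[u1 u2].
  (* [u - (-1)] and [1 - (-1)] become [1 + u] and [2] *)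
  rewrite /f3 [(2 `^ sigma)%:C * p]mulrC [(2 `^ tau)%:C * q]mulrC.
  rewrite opprK [u + 1]addrC [1 + 1](_ : _ = 2)//.
  by apply: ext_beta_integrand_affine; lra.
have [B4 I4] : B = rcpow (c - a) (1 - eta1 - eta2) * cintegral `]a, c[ f4 /\
    (cintegrable `]0, 1[ f0 <-> cintegrable `]a, c[ f4).
  apply: substitution_cintegral_scaled (substitution_affine _ _ lt_ac)
    (rcpow_neq0 _ _) _ => u.
  rewrite /= in_itv /= => /andP[u1 u2].
  by apply: ext_beta_integrand_affine; lra.
rewrite mul1r in B2.
exact: (conj (And4 B1 B2 B3 B4) (And4 I1 I2 I3 I4)).
Qed.
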